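(* Let $f:\mathbb{R}^n\to(-\infty,+\infty]$ be proper, lower semicontinuous and prox-bounded with threshold $\lambda_f>0$, and let $0<\mu<\lambda_f$. Then the following hold (as identities or inclusions of set-valued maps on $\mathbb{R}^n$). (a) $\operatorname{conv}\operatorname{Prox}_{\mu}f=\partial\big(\mu f+\frac12\|\cdot\|^2\big)^*$. In particular, $\operatorname{conv}\operatorname{Prox}_{\mu}f$ is maximally monotone. (b) $-\partial_L\Big(-\big(\mu f+\frac12\|\cdot\|^2\big)^*\Big)\subseteq\operatorname{Prox}_{\mu}f$. (c) $$\partial_C(e_{\mu}f)=-\partial_L(-e_{\mu}f)=\frac{\operatorname{Id}-\operatorname{conv}\operatorname{Prox}_{\mu}f}{\mu}.$$ If, in addition, $f$ is $\mu$-proximal, then $$\partial_C(e_{\mu}f)=\frac{\operatorname{Id}-\operatorname{Prox}_{\mu}f}{\mu}.$$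
   Context: $\|\cdot\|$ is the Euclidean norm. $e_{\mu}f(x)=\inf_{w}\{f(w)+\frac{1}{2\mu}\|w-x\|^2\}$ (locally Lipschitz for $0<\mu<\lambda_f$) and $\operatorname{Prox}_{\mu}f(x)=\operatorname{argmin}_{w}\{f(w)+\frac{1}{2\mu}\|w-x\|^2\}$. $f$ is prox-bounded if there exist $\lambda>0$ and $x$ with $e_{\lambda}f(x)>-\infty$; the supremum of all such $\lambda$ is its threshold $\lambda_f\in(0,+\infty]$. $f$ is $\mu$-proximal if $f+\frac{1}{2\mu}\|\cdot\|^2$ is convex. $h^*$ is the Fenchel conjugate; $\operatorname{Id}$ is the identity. $\operatorname{conv}\operatorname{Prox}_\mu f$ is $x\mapsto\operatorname{conv}(\operatorname{Prox}_\mu f(x))$. Subdifferentials: Fenchel, $\partial h(x)=\{s:h(y)\ge h(x)+\langle s,y-x\rangle\ \forall y\}$; Fréchet, $\hat\partial h(x)=\{s:h(y)\ge h(x)+\langle s,y-x\rangle+o(\|y-x\|)\}$; limiting, $\partial_Lh(x)=\{v:\exists\,x_k\to x,\ h(x_k)\to h(x),\ s_k\in\hat\partial h(x_k),\ s_k\to v\}$; Clarke (for $h$ locally Lipschitz), $\partial_Ch(x)=\operatorname{conv}\partial_Lh(x)$. *)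

(* Defs.v *)
From mathcomp Require Import all_boot all_order all_algebra.
From mathcomp Require Import all_classical all_reals all_analysis.

Set Implicit Arguments.
Unset Strict Implicit.
Unset Printing Implicit Defensive.

Import Order.TTheory GRing.Theory Num.Theory.
Import numFieldNormedType.Exports.

Local Open Scope classical_set_scope.
Local Open Scope ring_scope.
Local Open Scope ereal_scope.

(* The library norm `|x| of a row vector is the sup norm, hence the explicit
   Euclidean structure; the library topology on 'rV[R]_n, used below for limits,
   neighborhoods and lower semicontinuity, is the Euclidean one. *)
Definition dotv (R : realType) (n : nat) (u v : 'rV[R]_n) : R :=
  (\sum_(i < n) u ord0 i * v ord0 i)%R.

Definition enorm (R : realType) (n : nat) (u : 'rV[R]_n) : R :=
  Num.sqrt (dotv u u).

Definition proper_fun (R : realType) (n : nat) (f : 'rV[R]_n -> \bar R) : Prop :=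
  (forall x, -oo < f x) /\ exists x, f x < +oo.

Definition prox_objective (R : realType) (n : nat) (mu : R)
    (f : 'rV[R]_n -> \bar R) (x w : 'rV[R]_n) : \bar R :=
  f w + ((2 * mu)^-1 * enorm (w - x) ^+ 2)%:E.

Definition moreau (R : realType) (n : nat) (mu : R)
    (f : 'rV[R]_n -> \bar R) (x : 'rV[R]_n) : \bar R :=
  ereal_inf [set prox_objective mu f x w | w in [set: 'rV[R]_n]].

Definition Prox (R : realType) (n : nat) (mu : R)
    (f : 'rV[R]_n -> \bar R) (x : 'rV[R]_n) : set 'rV[R]_n :=
  [set w | forall w', prox_objective mu f x w <= prox_objective mu f x w'].

Definition prox_bounded (R : realType) (n : nat)
    (f : 'rV[R]_n -> \bar R) : Prop :=
  exists lambda : R, (0 < lambda)%R /\ exists x, -oo < moreau lambda f x.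

Definition threshold (R : realType) (n : nat)
    (f : 'rV[R]_n -> \bar R) : \bar R :=
  ereal_sup [set lambda%:E | lambda in
    [set l : R | (0 < l)%R /\ exists x, -oo < moreau l f x]].

(* Only for functions that never take the value -oo; recall 0 * +oo = 0. *)
Definition econvex (R : realType) (n : nat) (h : 'rV[R]_n -> \bar R) : Prop :=
  forall (t : R) (x y : 'rV[R]_n), (0 <= t <= 1)%R ->
    h (t *: x + (1 - t) *: y)%R <= t%:E * h x + (1 - t)%:E * h y.

Definition mu_proximal (R : realType) (n : nat) (mu : R)
    (f : 'rV[R]_n -> \bar R) : Prop :=
  econvex (fun w => f w + ((2 * mu)^-1 * enorm w ^+ 2)%:E).

Definition mu_reg (R : realType) (n : nat) (mu : R)
    (f : 'rV[R]_n -> \bar R) (w : 'rV[R]_n) : \bar R :=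
  mu%:E * f w + (2^-1 * enorm w ^+ 2)%:E.

Definition fenchel_conj (R : realType) (n : nat)
    (h : 'rV[R]_n -> \bar R) (s : 'rV[R]_n) : \bar R :=
  ereal_sup [set (dotv s w)%:E - h w | w in [set: 'rV[R]_n]].

(* As usual for extended-real-valued functions, the subdifferentials are empty
   at points where the function is infinite. *)
Definition subdiff (R : realType) (n : nat)
    (h : 'rV[R]_n -> \bar R) (x : 'rV[R]_n) : set 'rV[R]_n :=
  [set s | h x \is a fin_num /\ forall y, h x + (dotv s (y - x))%:E <= h y].

(* The inequality up to o(||y - x||), with the little-o unfolded. *)
Definition frechet_subdiff (R : realType) (n : nat)
    (h : 'rV[R]_n -> \bar R) (x : 'rV[R]_n) : set 'rV[R]_n :=
  [set s | h x \is a fin_num /\ forall e : R, (0 < e)%R ->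
    \forall y \near x,
      h x + (dotv s (y - x) - e * enorm (y - x))%:E <= h y].

Definition limiting_subdiff (R : realType) (n : nat)
    (h : 'rV[R]_n -> \bar R) (x : 'rV[R]_n) : set 'rV[R]_n :=
  [set v | h x \is a fin_num /\ exists xk sk : nat -> 'rV[R]_n,
    [/\ xk k @[k --> \oo] --> x,
        h (xk k) @[k --> \oo] --> h x,
        forall k, frechet_subdiff h (xk k) (sk k) &
        sk k @[k --> \oo] --> v]].

Definition conv_hull (R : realType) (n : nat) (A : set 'rV[R]_n)
    : set 'rV[R]_n :=
  smallest (@convex_set R 'rV[R]_n) A.

(* Meant for locally Lipschitz h. *)
Definition clarke_subdiff (R : realType) (n : nat)
    (h : 'rV[R]_n -> \bar R) (x : 'rV[R]_n) : set 'rV[R]_n :=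
  conv_hull (limiting_subdiff h x).

Definition monotone_op (R : realType) (n : nat)
    (T : 'rV[R]_n -> set 'rV[R]_n) : Prop :=
  forall x y u v, T x u -> T y v -> (0 <= dotv (u - v) (x - y))%R.

Definition maximally_monotone (R : realType) (n : nat)
    (T : 'rV[R]_n -> set 'rV[R]_n) : Prop :=
  monotone_op T /\
  forall T' : 'rV[R]_n -> set 'rV[R]_n, monotone_op T' ->
    (forall x, T x `<=` T' x) -> forall x, T' x `<=` T x.

Definition oppset (R : realType) (n : nat) (A : set 'rV[R]_n) : set 'rV[R]_n :=
  [set (- s)%R | s in A].

Definition id_minus_over (R : realType) (n : nat) (mu : R)
    (P : 'rV[R]_n -> set 'rV[R]_n) (x : 'rV[R]_n) : set 'rV[R]_n :=
  [set (mu^-1 *: (x - p))%R | p in P x].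

(* Main.v *)
(* Let g = mu f + |.|^2 / 2 and H = g^*. Expanding the square gives
   <x, w> - g(w) = |x|^2 / 2 - mu (f(w) + |w - x|^2 / (2 mu)), so Prox_mu f(x)
   is the set of maximizers defining H(x), e_mu f = (|.|^2 / 2 - H) / mu, and H
   is finite and convex. Since mu < lambda_f, Prox_mu f is nonempty, locally
   bounded and has a closed graph. Writing G = - d_L(- H), everything follows
   from the chain G <= Prox_mu f <= d H <= conv G:
   - a Frechet subgradient v of - H at y forces d H(y) = {- v}, hence
     Prox_mu f(y) = {- v}, and the first inclusion follows in the limit;
   - the last inclusion is strict separation from the compact set conv G
     (compact by Caratheodory), since points where - H is Frechet
     subdifferentiable are dense.
   Adding a multiple of |.|^2 / 2 only translates the limiting subdifferential,
   which transfers the result to e_mu f and - e_mu f. *)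
Require Import Defs.
From mathcomp Require Import all_boot all_order all_algebra.
From mathcomp Require Import all_classical all_reals all_analysis.
From mathcomp Require Import ring lra.
Import Order.TTheory GRing.Theory Num.Theory.
Import numFieldNormedType.Exports.

Set Implicit Arguments.
Unset Strict Implicit.
Unset Printing Implicit Defensive.

Local Open Scope classical_set_scope.
Local Open Scope ereal_scope.

(** * Euclidean inner product and norm, and their link with the library topology *)

Section euclidean.
Local Open Scope ring_scope.
Variables (R : realType) (n : nat).
Local Notation V := 'rV[R]_n.
Implicit Types (u v w x y : V) (a b : R).

Lemma dotvC u v : dotv u v = dotv v u.
Proof. by apply: eq_bigr => i _; rewrite mulrC. Qed.

Lemma dotvDl u v w : dotv (u + v) w = dotv u w + dotv v w.
Proof. by rewrite -big_split; apply: eq_bigr => i _; rewrite mxE mulrDl. Qed.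

Lemma dotvZl a u v : dotv (a *: u) v = a * dotv u v.
Proof. by rewrite mulr_sumr; apply: eq_bigr => i _; rewrite mxE mulrA. Qed.

Lemma dotvNl u v : dotv (- u) v = - dotv u v.
Proof. by rewrite -scaleN1r dotvZl mulN1r. Qed.

Lemma dotvDr u v w : dotv w (u + v) = dotv w u + dotv w v.
Proof. by rewrite !(dotvC w) dotvDl. Qed.

Lemma dotvZr a u v : dotv u (a *: v) = a * dotv u v.
Proof. by rewrite !(dotvC u) dotvZl. Qed.

Lemma dotvNr u v : dotv u (- v) = - dotv u v.
Proof. by rewrite !(dotvC u) dotvNl. Qed.

Definition dotvE := (dotvDl, dotvDr, dotvNl, dotvNr, dotvZl, dotvZr).

Lemma dotv0l u : dotv 0 u = 0.
Proof. by rewrite -(scale0r (0 : V)) dotvZl mul0r. Qed.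

Lemma dotv0r u : dotv u 0 = 0.
Proof. by rewrite dotvC dotv0l. Qed.

Lemma dotvv_ge0 u : 0 <= dotv u u.
Proof. by apply: sumr_ge0 => i _; rewrite -expr2 sqr_ge0. Qed.

Lemma dotvv_eq0 u : dotv u u = 0 -> u = 0.
Proof.
move=> /eqP; rewrite psumr_eq0 => [/allP u0|i _]; last by rewrite -expr2 sqr_ge0.
apply/rowP => i; rewrite mxE; have := u0 i (mem_index_enum _).
by rewrite /= mulf_eq0 orbb => /eqP.
Qed.

Lemma enorm_ge0 u : 0 <= enorm u.
Proof. exact: sqrtr_ge0. Qed.

Lemma enorm_sqr u : enorm u ^+ 2 = dotv u u.
Proof. by rewrite sqr_sqrtr// dotvv_ge0. Qed.

Lemma enorm0 : enorm (0 : V) = 0.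
Proof. by rewrite /enorm dotv0l sqrtr0. Qed.

Lemma enorm_eq0 u : enorm u = 0 -> u = 0.
Proof. by move=> u0; apply: dotvv_eq0; rewrite -enorm_sqr u0 expr0n. Qed.

Lemma enormZ a u : enorm (a *: u) = `|a| * enorm u.
Proof.
by rewrite /enorm dotvZl dotvZr mulrA -expr2 sqrtrM ?sqr_ge0// sqrtr_sqr.
Qed.

Lemma enormN u : enorm (- u) = enorm u.
Proof. by rewrite -scaleN1r enormZ normrN1 mul1r. Qed.

Lemma enormC u v : enorm (u - v) = enorm (v - u).
Proof. by rewrite -enormN opprB. Qed.

Lemma cauchy_schwarz u v : `|dotv u v| <= enorm u * enorm v.
Proof.
rewrite -sqrtrM ?dotvv_ge0// -sqrtr_sqr ler_wsqrtr//.
have [v0|v0] := eqVneq (dotv v v) 0.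
  by rewrite (dotvv_eq0 v0) !dotv0r mulr0 expr0n.
have vp : 0 < dotv v v by rewrite lt_def v0 dotvv_ge0.
rewrite -(ler_pM2l vp).
have := dotvv_ge0 (dotv v v *: u - dotv u v *: v).
rewrite !dotvE (dotvC v u); set a := dotv v v; set b := dotv u v.
set c := dotv u u; nra.
Qed.

Lemma dotv_le u v : dotv u v <= enorm u * enorm v.
Proof. exact: le_trans (ler_norm _) (cauchy_schwarz u v). Qed.

Lemma enormD u v : enorm (u + v) <= enorm u + enorm v.
Proof.
rewrite -(@ler_pXn2r _ 2)// ?nnegrE ?addr_ge0 ?enorm_ge0//.
rewrite sqrrD !enorm_sqr !dotvE (dotvC v u) mulr2n.
by have := dotv_le u v; lra.
Qed.

Lemma enorm_tri u v w : enorm (u - w) <= enorm (u - v) + enorm (v - w).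
Proof. by rewrite (_ : u - w = (u - v) + (v - w)) ?enormD// addrA subrK. Qed.

Lemma norm_le_enorm u : `|u| <= enorm u.
Proof.
rewrite [leLHS]mx_normrE; apply: bigmax_le => [|[i j] _]; first exact: enorm_ge0.
rewrite /= (ord1 i) -sqrtr_sqr ler_wsqrtr// /dotv (bigD1 j)//= -expr2 lerDl.
by apply: sumr_ge0 => k _; rewrite -expr2 sqr_ge0.
Qed.

Lemma cvg_dotv (T : Type) (F : set_system T) {FF : Filter F} (f g : T -> V) u v :
  f @ F --> u -> g @ F --> v -> (fun t => dotv (f t) (g t)) @ F --> dotv u v.
Proof.
move=> fu gv; apply: cvg_big => [|i _]; first exact: add_continuous.
apply: cvgM.
  exact: (cvg_comp _ _ fu (@coord_continuous _ _ _ ord0 i u)).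
exact: (cvg_comp _ _ gv (@coord_continuous _ _ _ ord0 i v)).
Qed.

Lemma cvg_enorm (T : Type) (F : set_system T) {FF : Filter F} (f : T -> V) u :
  f @ F --> u -> (fun t => enorm (f t)) @ F --> enorm u.
Proof.
move=> fu; apply: (cvg_comp (fun t => dotv (f t) (f t)) Num.sqrt).
  exact: (cvg_dotv fu fu).
exact: sqrt_continuous.
Qed.

Lemma continuous_enormB x : continuous (fun y : V => enorm (y - x)).
Proof.
move=> y; apply: (@cvg_enorm _ (nbhs y) _ (fun z => z - x)).
by apply: cvgB; [exact: cvg_id|exact: cvg_cst].
Qed.

Lemma continuous_enormB_sqr x : continuous (fun y : V => enorm (y - x) ^+ 2).
Proof.
move=> y; rewrite /continuous_at expr2; under eq_fun do rewrite expr2.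
exact: (cvgM (@continuous_enormB x y) (@continuous_enormB x y)).
Qed.

Lemma continuous_quadratic x a b :
  continuous (fun y : V => a * enorm (y - x) ^+ 2 + b).
Proof.
move=> y; apply: (@cvgD _ _ _ (nbhs y) (nbhs_filter _)
  (fun z => a * enorm (z - x) ^+ 2) (fun=> b)); last exact: cvg_cst.
apply: (@cvgM _ _ (nbhs y) (nbhs_filter _)); first exact: cvg_cst.
exact: continuous_enormB_sqr.
Qed.

(** A Euclidean ball lies in the sup-norm ball of the same radius; conversely, continuity of [enorm]
    replaces an explicit comparison constant. *)
Lemma near_enorm x (P : V -> Prop) :
  (\forall y \near x, P y) <->
  exists2 d : R, 0 < d & forall y, enorm (y - x) < d -> P y.
Proof.
split => [/nbhs_ballP[d d0 dP]|[d d0 dP]].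
  exists d => // y yx; apply: dP; rewrite mx_norm_ball /ball_/= distrC.
  exact: le_lt_trans (norm_le_enorm _) yx.
have := @continuous_enormB x x.
rewrite /continuous_at subrr enorm0 => /cvgr_lt/(_ _ d0); apply: filterS => y; exact: dP.
Qed.

Lemma cvg_enormP (u : nat -> V) x :
  (forall e : R, 0 < e -> \forall k \near \oo, enorm (u k - x) < e) ->
  u @ \oo --> x.
Proof.
move=> ux; apply/cvgrPdist_lt => e /ux; apply: filterS => k.
by rewrite distrC; exact: le_lt_trans (norm_le_enorm _).
Qed.

Lemma eball_compact x (r : R) : compact [set y : V | enorm (y - x) <= r].
Proof.
apply: bounded_closed_compact.
  exists (r + enorm x); split; first exact: num_real.
  move=> M rM y /= yx; apply: le_trans (norm_le_enorm _) _.
  have := enormD (y - x) x; rewrite subrK; lra.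
have -> : [set y : V | enorm (y - x) <= r] =
    (fun y : V => enorm (y - x)) @^-1` [set t | t <= r] by [].
apply: preimage_closed; last exact: closed_le.
by move=> y _; exact: continuous_enormB.
Qed.

End euclidean.

(** * Convex hulls in finite dimension: Carathéodory's theorem and strict separation *)

Section convex_hull.
Local Open Scope ring_scope.
Variables (R : realType) (n : nat).
Local Notation V := 'rV[R]_n.
Implicit Types (A : set V) (x y : V).

Lemma convex_setP A :
  @convex_set R V A <->
  forall x y (t : R), 0 <= t <= 1 -> A x -> A y -> A (t *: x + (1 - t) *: y).
Proof.
split => [cA x y t t01 Ax Ay|cA x y l /set_mem Ax /set_mem Ay].
  have [t0 t1] := andP t01.
  by have /set_mem := cA x y (Itv01 t0 t1) (mem_set Ax) (mem_set Ay).
by apply/mem_set; apply: (cA x y l%:num) => //; rewrite ge0 le1.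
Qed.

Lemma conv_hull_convex A x y (t : R) : 0 <= t <= 1 ->
  conv_hull A x -> conv_hull A y -> conv_hull A (t *: x + (1 - t) *: y).
Proof.
move=> t01 Ax Ay B [cB AB]; move/convex_setP : (cB); apply=> //.
  exact: Ax.
exact: Ay.
Qed.

Lemma conv_hull_sub A (B : set V) :
  (forall x y (t : R), 0 <= t <= 1 -> B x -> B y -> B (t *: x + (1 - t) *: y)) ->
  A `<=` B -> conv_hull A `<=` B.
Proof. by move=> /convex_setP cB AB; exact: smallest_sub. Qed.

Lemma sub_conv_hull A : A `<=` conv_hull A.
Proof. exact: sub_gen_smallest. Qed.

Lemma conv_hull_id A :
  (forall x y (t : R), 0 <= t <= 1 -> A x -> A y -> A (t *: x + (1 - t) *: y)) ->
  conv_hull A = A.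
Proof. by move=> /convex_setP; exact: smallest_id. Qed.

Lemma conv_hullS A (B : set V) : A `<=` B -> conv_hull A `<=` conv_hull B.
Proof.
move=> AB; apply: conv_hull_sub => [x y t|]; first exact: conv_hull_convex.
exact: subset_trans AB (@sub_conv_hull B).
Qed.

(** Both inclusions are minimality of the hull: images and preimages of convex sets under an affine
    map are convex. *)
Lemma conv_hull_image (F : V -> V) A :
  (forall x y (t : R), F (t *: x + (1 - t) *: y) = t *: F x + (1 - t) *: F y) ->
  conv_hull (F @` A) = F @` conv_hull A.
Proof.
move=> aF; apply/seteqP; split.
  apply: conv_hull_sub => [_ _ t t01 [x Ax <-] [y Ay <-]|_ [x Ax <-]].
    by exists (t *: x + (1 - t) *: y) => //; exact: conv_hull_convex.
  by exists x => //; exact: sub_conv_hull.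
move=> _ [x + <-]; move: x; apply: conv_hull_sub => [x y t t01 Fx Fy|x Ax].
  by rewrite aF; exact: conv_hull_convex.
by apply: sub_conv_hull; exists x.
Qed.

(** The number of terms is fixed, with zero weights allowed, so that compactness passes from [A] to
    this set. *)
Definition convcomb k A : set V :=
  [set x | exists (p : 'I_k -> R) (a : 'I_k -> V),
    [/\ forall i, 0 <= p i, \sum_i p i = 1, forall i, A (a i) &
        x = \sum_i p i *: a i]].

Lemma convcomb_sub_hull k A : convcomb k A `<=` conv_hull A.
Proof.
move=> _ [p [a [p0 p1 aA ->]]].
elim: k p a p0 p1 aA => [|k IH] p a p0 p1 aA.
  by move: p1 => /eqP; rewrite big_ord0 eq_sym oner_eq0.
move: p1; rewrite !big_ord_recl => p1.
set q := \sum_(i < k) p (lift ord0 i) in p1.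
have q0 : 0 <= q by exact: sumr_ge0.
have [qE|qN] := eqVneq q 0.
  rewrite big1 => [|i _].
    by move: p1; rewrite qE !addr0 => ->; rewrite scale1r; exact: sub_conv_hull.
  have /eqP := qE; rewrite psumr_eq0// => /allP/(_ i (mem_index_enum _))/eqP ->.
  exact: scale0r.
have -> : \sum_(i < k) p (lift ord0 i) *: a (lift ord0 i) =
    (1 - p ord0) *: (\sum_(i < k) (q^-1 * p (lift ord0 i)) *: a (lift ord0 i)).
  rewrite scaler_sumr; apply: eq_bigr => i _; rewrite scalerA mulrA.
  by rewrite -p1 addrC addKr divff// mul1r.
apply: conv_hull_convex; first by rewrite p0/= -p1 lerDl.
  exact: sub_conv_hull.
apply: IH => // [i|]; first by rewrite mulr_ge0// invr_ge0.
by rewrite -mulr_sumr mulVf.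
Qed.

(** The matrix with rows [(a i, 1)] has more rows than columns, hence a nonzero left kernel vector.
    Its entries sum to zero, so one of them is positive. *)
Lemma affine_dependence (a : 'I_n.+2 -> V) : exists u : 'I_n.+2 -> R,
  [/\ exists j, 0 < u j, \sum_i u i = 0 & \sum_i u i *: a i = 0].
Proof.
pose M : 'M[R]_(n.+2, n + 1) := row_mx (\matrix_i a i) (const_mx 1).
have : kermx M != 0.
  rewrite -mxrank_eq0 mxrank_ker subn_eq0 -ltnNge.
  by rewrite (leq_ltn_trans (rank_leq_col M))// addn1.
move=> /rowV0Pn[u /sub_kermxP uM u0]; exists (u ord0).
move: uM; rewrite mul_mx_row -row_mx0 => /eq_row_mx[ua u1].
have us : \sum_i u ord0 i = 0.
  move/rowP/(_ ord0) : u1; rewrite !mxE => u1; rewrite -[RHS]u1.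
  by apply: eq_bigr => i _; rewrite mxE mulr1.
split => //; last first.
  rewrite -[RHS]ua mulmx_sum_row.
  by apply: eq_bigr => i _; rewrite rowK.
apply/not_existsP => uN; move/negP: u0; apply; apply/eqP/rowP => i.
have uN0 j : 0 <= - u ord0 j by rewrite oppr_ge0 leNgt; apply/negP/uN.
have /eqP : \sum_i - u ord0 i = 0 by rewrite sumrN us oppr0.
rewrite psumr_eq0// => /allP/(_ i (mem_index_enum _)).
by rewrite mxE /= oppr_eq0 => /eqP.
Qed.

(** Moving the weights along an affine dependence preserves the combination; the smallest ratio
    [p i / u i] is where the first weight vanishes, and that term is dropped. *)
Lemma caratheodory A : convcomb n.+2 A `<=` convcomb n.+1 A.
Proof.
move=> _ [p [a [p0 p1 aA ->]]].
have [u [[j0 uj0] u0 ua]] := affine_dependence a.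
pose j := [arg min_(i < j0 | 0 < u i) (p i / u i)]%O.
have [uj jmin] : 0 < u j /\ forall i, 0 < u i -> p j / u j <= p i / u i.
  by rewrite /j; case: arg_minP.
pose q i := p i - p j / u j * u i.
have q0 i : 0 <= q i.
  rewrite subr_ge0; have [ui|ui] := ltP 0 (u i).
    by rewrite -ler_pdivlMr// jmin.
  by rewrite (le_trans _ (p0 i))// mulr_ge0_le0// divr_ge0// ltW.
have qj : q j = 0 by rewrite /q divfK ?subrr// gt_eqF.
exists (q \o lift j), (a \o lift j); split => //=.
  have : \sum_i q i = 1 by rewrite sumrB p1 -mulr_sumr u0 mulr0 subr0.
  by rewrite (bigD1_ord j)//= qj add0r.
have -> : \sum_i p i *: a i = \sum_i q i *: a i.
  under [RHS]eq_bigr do rewrite scalerBl -scalerA.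
  by rewrite sumrB -scaler_sumr ua scaler0 subr0.
by rewrite (bigD1_ord j)//= qj scale0r add0r.
Qed.

Lemma convcomb_segment k A x a (t : R) : 0 <= t <= 1 ->
  convcomb k A x -> A a -> convcomb k.+1 A (t *: a + (1 - t) *: x).
Proof.
move=> /andP[t0 t1] [p [b [p0 p1 bA ->]]] Aa.
exists (fun i => if unlift ord0 i is Some j then (1 - t) * p j else t).
exists (fun i => if unlift ord0 i is Some j then b j else a).
split => [i||i|].
- by case: unliftP => // j _; rewrite mulr_ge0// subr_ge0.
- rewrite big_ord_recl unlift_none; under eq_bigr do rewrite liftK.
  by rewrite -mulr_sumr p1 mulr1 addrC subrK.
- by case: unliftP.
- rewrite big_ord_recl unlift_none; under [in RHS]eq_bigr do rewrite liftK -scalerA.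
  by rewrite -scaler_sumr.
Qed.

Lemma convcomb1 k A x : A x -> convcomb k.+1 A x.
Proof.
move=> Ax; exists (fun i => (i == ord0)%:R), (fun=> x); split => //.
  by rewrite (bigD1 ord0)//= big1 ?addr0// => i /negbTE ->.
by rewrite (bigD1 ord0)//= scale1r big1 ?addr0// => i /negbTE ->; rewrite scale0r.
Qed.

(** A continuous image of the product of the standard simplex with a power of [A]. *)
Lemma convcomb_compact k A : compact A -> compact (convcomb k A).
Proof.
move=> cA.
pose S := [set p : 'rV[R]_k | forall i, `[0, 1]%classic (p ord0 i)] `&`
          [set p | \sum_i p ord0 i = 1].
pose T := [set a : 'rV[V]_k | forall i, A (a ord0 i)].
have cS : compact S.
  apply: compact_closedI.
    apply: (@rV_compact R k (fun=> `[0, 1]%classic)) => i.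
    exact: segment_compact.
  apply: (@preimage_closed _ _ (fun p : 'rV[R]_k => \sum_i p ord0 i) [set 1]).
    move=> p _; apply: continuous_big => [|i _]; first exact: add_continuous.
    exact: coord_continuous.
  exact: closed_eq.
have cT : compact T by apply: (@rV_compact V k (fun=> A)).
pose F (z : 'rV[R]_k * 'rV[V]_k) : V := \sum_i z.1 ord0 i *: z.2 ord0 i.
have -> : convcomb k A = F @` (S `*` T).
  apply/seteqP; split => [_ [p [a [p0 p1 aA ->]]]|_ [[p a] [[/= p0 p1] aA] <-]].
    exists (\row_i p i, \row_i a i); last first.
      by apply: eq_bigr => i _; rewrite !mxE.
    split => [|i /=]; last by rewrite mxE.
    split => [i|] /=; last by under eq_bigr do rewrite mxE.
    rewrite mxE in_itv/= p0 /= -p1 (bigD1 i)//= lerDl.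
    by apply: sumr_ge0.
  exists (fun i => p ord0 i), (fun i => a ord0 i); split => // i.
  by have := p0 i; rewrite /= in_itv/= => /andP[].
apply: continuous_compact; last exact: compact_setX.
apply: continuous_subspaceT.
apply: continuous_big => [|i _ [p a]]; first exact: add_continuous.
apply: cvgZ.
  apply: (cvg_comp fst (fun p : 'rV[R]_k => p ord0 i) cvg_fst).
  exact: coord_continuous.
apply: (cvg_comp snd (fun a : 'rV[V]_k => a ord0 i) cvg_snd).
move=> U Ua; exists (fun _ j => if j == i then U else setT).
  by move=> ? j; rewrite ord1; case: eqVneq => [->//|_]; exact: filterT.
by move=> b /(_ ord0 i); rewrite eqxx.
Qed.

(** The direction goes from a nearest point [c] of the compact set [C] towards [s]. *)
Lemma strict_separation A s : compact A -> ~ conv_hull A s ->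
  exists d : V, forall a, A a -> dotv a d < dotv s d.
Proof.
move=> cA sA.
have [->|/set0P[a0 Aa0]] := eqVneq A set0; first by exists 0.
pose C := convcomb n.+1 A.
have [c /set_mem Cc cmin] : exists2 c, c \in C &
    forall t, t \in C -> enorm (c - s) <= enorm (t - s).
  apply: (@EVT_min_rV _ _ (fun c => enorm (c - s))).
  - by exists a0; exact: convcomb1.
  - exact: convcomb_compact.
  - by apply: continuous_subspaceT; exact: continuous_enormB.
exists (s - c) => a Aa.
have cs : 0 < dotv (s - c) (s - c).
  rewrite lt_def dotvv_ge0 andbT; apply: contra_notN sA => /eqP/dotvv_eq0/subr0_eq ->.
  exact: convcomb_sub_hull Cc.
suff : dotv (a - c) (s - c) <= 0 by move: cs; rewrite !dotvE; lra.
(* Compare [c] with the point at parameter [t] on the segment from [c] to [a], which [caratheodory]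
   puts back in [C]. *)
have key t : 0 < t <= 1 -> 2 * dotv (a - c) (s - c) <= t * dotv (a - c) (a - c).
  move=> /andP[t0 t1].
  have : C (t *: a + (1 - t) *: c).
    by apply: caratheodory; apply: convcomb_segment => //; rewrite ltW.
  move=> /mem_set/cmin; rewrite -(@ler_pXn2r _ 2)// ?nnegrE ?enorm_ge0//.
  rewrite !enorm_sqr.
  have -> : t *: a + (1 - t) *: c - s = t *: (a - c) - (s - c).
    by apply/rowP => i; rewrite !mxE; ring.
  rewrite -(opprB s c); move: (a - c) (s - c) => b w.
  rewrite !dotvE (dotvC w b) => H.
  by rewrite -(ler_pM2l t0); lra.
rewrite leNgt; apply/negP => d0.
have e0 := dotvv_ge0 (a - c).
set D := dotv (a - c) (s - c) in key d0 *; set E := dotv (a - c) (a - c) in key e0.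
have DE : 0 < D + E by lra.
have := key (D / (D + E)); rewrite divr_gt0//= ler_pdivrMr// mul1r lerDl e0.
move=> /(_ isT); rewrite mulrAC ler_pdivlMr//; nra.
Qed.

End convex_hull.

(** * Fréchet and limiting subgradients of real-valued functions *)

Section subdifferentials.
Local Open Scope ring_scope.
Variables (R : realType) (n : nat).
Local Notation V := 'rV[R]_n.
Implicit Types (phi : V -> R) (s v w x y z : V).

Lemma subdiff_EFin phi x s :
  subdiff (EFin \o phi) x s <-> forall y, phi x + dotv s (y - x) <= phi y.
Proof.
split=> [[_ sx] y|sx]; first by rewrite -lee_fin EFinD; exact: sx.
by split=> // y; rewrite /= -EFinD lee_fin.
Qed.

Lemma frechet_EFin phi x s :
  frechet_subdiff (EFin \o phi) x s <-> forall e : R, 0 < e ->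
  exists2 d : R, 0 < d & forall y, enorm (y - x) < d ->
    phi x + (dotv s (y - x) - e * enorm (y - x)) <= phi y.
Proof.
split=> [[_ sx] e /sx/near_enorm[d d0 dP]|sx].
  by exists d => // y /dP; rewrite /= -EFinD lee_fin.
by split=> // e /sx[d d0 dP]; apply/near_enorm; exists d.
Qed.

Lemma subdiff_frechet phi x s :
  subdiff (EFin \o phi) x s -> frechet_subdiff (EFin \o phi) x s.
Proof.
move=> /subdiff_EFin sx; apply/frechet_EFin => e e0; exists 1 => // y _.
have := sx y; have := mulr_ge0 (ltW e0) (enorm_ge0 (y - x)); lra.
Qed.

(** Continuity takes care of the convergence of values, and approximations at scale [1 / (k + 1)]
    give the sequences. *)
Lemma limiting_EFin phi x v : continuous phi ->
  limiting_subdiff (EFin \o phi) x v <-> forall e : R, 0 < e ->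
  exists y s, [/\ enorm (y - x) < e, frechet_subdiff (EFin \o phi) y s
                & enorm (s - v) < e].
Proof.
move=> cphi; split=> [[_ [xk [sk [xkx _ fk skv]]]] e e0|H].
  have ball z : \forall y \near z, enorm (y - z) < e by apply/near_enorm; exists e.
  have Fx : \forall k \near \oo, enorm (xk k - x) < e := xkx _ (ball x).
  have Fs : \forall k \near \oo, enorm (sk k - v) < e := skv _ (ball v).
  have [k [xke ske]] := filter_ex (filterI Fx Fs).
  by exists (xk k), (sk k); split.
split=> //.
have /choice[z zP] (k : nat) : exists z : V * V,
    [/\ enorm (z.1 - x) < k.+1%:R^-1, frechet_subdiff (EFin \o phi) z.1 z.2
                & enorm (z.2 - v) < k.+1%:R^-1].
  by have [|y [s yP]] := H k.+1%:R^-1; [rewrite invr_gt0|exists (y, s)].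
have small e : 0 < e -> \forall k \near \oo, (k.+1%:R^-1 : R) < e.
  by move=> e0; exact: (near_infty_natSinv_lt (PosNum e0)).
have z1x : (z k).1 @[k --> \oo] --> x.
  apply: cvg_enormP => e /small; apply: filterS => k.
  by apply: lt_trans; have [] := zP k.
exists (fst \o z), (snd \o z); split => //.
- by apply: cvg_EFin; [exact: nearW|exact: (cvg_comp _ _ z1x (cphi x))].
- by move=> k; have [] := zP k.
- apply: cvg_enormP => e /small; apply: filterS => k.
  by apply: lt_trans; have [] := zP k.
Qed.

Lemma limiting_closed phi x : continuous phi ->
  closed (limiting_subdiff (EFin \o phi) x).
Proof.
move=> cphi v vcl; apply/(limiting_EFin _ _ cphi) => e e0.
have e2 : 0 < e / 2 by rewrite divr_gt0.
have [|w [/(limiting_EFin _ _ cphi)/(_ _ e2)[y [s [yx ys sw]]] /= wv]] :=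
    vcl [set w | enorm (w - v) < e / 2].
  by apply/near_enorm; exists (e / 2).
exists y, s; split => //; first by rewrite (lt_trans yx)// ltr_pdivrMr//; lra.
by have := enorm_tri s w v; lra.
Qed.

(** The quadratic term has gradient [a *: x] at [x], and its second-order remainder is absorbed by
    the little-o. *)
Lemma frechet_quad phi (c a : R) x v : 0 < c ->
  frechet_subdiff (EFin \o phi) x v ->
  frechet_subdiff (EFin \o (fun y => c * phi y + a * (2^-1 * enorm y ^+ 2))) x
    (c *: v + a *: x).
Proof.
move=> c0 /frechet_EFin vx; apply/frechet_EFin => e e0.
(* Half of the error goes to [phi], hence the division by [2 * c]. The second radius below bounds
   the quadratic remainder by the other half, its summand 1 covering [a = 0]. *)
have [|d d0 dP] := vx (e / (2 * c)); first by rewrite divr_gt0// mulr_gt0.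
exists (Num.min d (e / (1 + `|a|))).
  by rewrite lt_min d0 divr_gt0// ltr_pwDl.
move=> y; have [h ->] : exists h, y = x + h by exists (y - x); rewrite addrC subrK.
rewrite [x + h - x]addrAC subrr add0r lt_min => /andP[hd].
have := dP (x + h); rewrite [x + h - x]addrAC subrr add0r => /(_ hd).
rewrite -(ler_pM2l c0).
have -> : c * (phi x + (dotv v h - e / (2 * c) * enorm h)) =
  c * phi x + c * dotv v h - e / 2 * enorm h by field; rewrite gt_eqF.
rewrite ltr_pdivlMr ?ltr_pwDl// !enorm_sqr !dotvE (dotvC h x) => hx ha.
have h0 := enorm_ge0 h; have hh := enorm_sqr h.
have : - (`|a| * enorm h ^+ 2) <= a * enorm h ^+ 2.
  by rewrite -mulNr ler_wpM2r ?sqr_ge0// lerNl -normrN ler_norm.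
have : enorm h * (enorm h * (1 + `|a|)) <= enorm h * e by rewrite ler_wpM2l// ltW.
have := sqr_ge0 (enorm h); rewrite -hh !expr2; lra.
Qed.

Lemma limiting_quad phi (c a : R) x v : 0 < c -> continuous phi ->
  limiting_subdiff (EFin \o phi) x v ->
  limiting_subdiff (EFin \o (fun y => c * phi y + a * (2^-1 * enorm y ^+ 2))) x
    (c *: v + a *: x).
Proof.
move=> c0 cphi [_ [xk [sk [xkx _ fk skv]]]]; split => //.
exists xk, (fun k => c *: sk k + a *: xk k); split => //.
- apply: cvg_EFin; first exact: nearW.
  apply: cvgD; first by apply: cvgM; [exact: cvg_cst|exact: (cvg_comp _ _ xkx (cphi x))].
  apply: cvgM; first exact: cvg_cst.
  apply: cvgM; first exact: cvg_cst.
  rewrite expr2; under eq_fun do rewrite expr2.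
  by apply: cvgM; exact: (cvg_enorm xkx).
- by move=> k; exact: frechet_quad.
- by apply: cvgD; apply: cvgZ => //; exact: cvg_cst.
Qed.

(** The transformation of [phi] is invertible within the same family, so the reverse inclusion is
    [limiting_quad] for the coefficients [c^-1] and [- (c^-1 * a)]. *)
Lemma limiting_quadE phi (c a : R) x : 0 < c -> continuous phi ->
  limiting_subdiff (EFin \o (fun y => c * phi y + a * (2^-1 * enorm y ^+ 2))) x =
  [set c *: v + a *: x | v in limiting_subdiff (EFin \o phi) x].
Proof.
move=> c0 cphi; have cN0 : c != 0 by rewrite gt_eqF.
apply/seteqP; split=> [w wx|_ [v vx <-]]; last exact: limiting_quad.
exists (c^-1 *: w + (- (c^-1 * a)) *: x); last first.
  by apply/rowP => i; rewrite !mxE; field.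
pose psi y := c * phi y + a * (2^-1 * enorm y ^+ 2).
have -> : phi = fun y => c^-1 * psi y + - (c^-1 * a) * (2^-1 * enorm y ^+ 2).
  by apply/funext => y; rewrite /psi; field.
apply: limiting_quad => //; first by rewrite invr_gt0.
rewrite (_ : psi = fun y => (a / 2 * enorm (y - 0) ^+ 2 + 0) + c * phi y).
  move=> y; apply: (@cvgD _ _ _ (nbhs y) (nbhs_filter _)).
    exact: continuous_quadratic.
  by apply: (@cvgM _ _ (nbhs y) (nbhs_filter _)); [exact: cvg_cst|exact: cphi].
by apply/funext => y; rewrite /psi subr0; field.
Qed.

End subdifferentials.

(** * Subgradients of a finite convex function and of its negative *)

Section finite_convex.
Local Open Scope ring_scope.
Variables (R : realType) (n : nat).
Local Notation V := 'rV[R]_n.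
Implicit Types (s v w x y z : V).
Variable H : V -> R.

Let dH x : set V := subdiff (EFin \o H) x.

(** This takes the place of convexity: a subgradient at every point makes [H] a supremum of affine
    functions, and the local bound yields Lipschitz estimates. *)
Hypothesis dH_bounded : forall x, exists2 d : R, 0 < d & exists M : R,
  forall y, enorm (y - x) < d -> exists2 s, dH y s & enorm s <= M.

Lemma subdiff_neq0 x : exists s, dH x s.
Proof.
have [d d0 [M]] := dH_bounded x.
by move=> /(_ x); rewrite subrr enorm0 => /(_ d0)[s]; exists s.
Qed.

Lemma subdiff_monotone : monotone_op dH.
Proof.
move=> x y u v /subdiff_EFin/(_ y) + /subdiff_EFin/(_ x).
by rewrite -(opprB x y); move: (x - y) => h; rewrite !dotvE; lra.
Qed.

Lemma subdiff_convex x s t (l : R) : 0 <= l <= 1 -> dH x s -> dH x t ->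
  dH x (l *: s + (1 - l) *: t).
Proof.
move=> /andP[l0 l1] /subdiff_EFin sx /subdiff_EFin tx; apply/subdiff_EFin => y.
move: (sx y) (tx y); move: (y - x) => h; rewrite !dotvE => sh th.
have := ler_wpM2l l0 sh.
have l1' : 0 <= 1 - l by rewrite subr_ge0.
have := ler_wpM2l l1' th; lra.
Qed.

(** The hypothesis bounds one subgradient per point, which suffices for the Lipschitz estimate; that
    estimate then bounds all the others. *)
Lemma locally_lipschitz x : exists2 d : R, 0 < d & exists2 M : R, 0 < M &
  (forall y z, enorm (y - x) < d -> enorm (z - x) < d ->
    H z - H y <= M * enorm (z - y)) /\
  (forall y s, enorm (y - x) < d -> dH y s -> enorm s <= M).
Proof.
have [d d0 [M0 HM]] := dH_bounded x.
pose M : R := Num.max 1 M0.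
have M0' : 0 < M by rewrite lt_max ltr01.
have lip y z : enorm (y - x) < d -> enorm (z - x) < d ->
    H z - H y <= M * enorm (z - y).
  move=> yx /HM[s /subdiff_EFin/(_ y) + sM].
  have : enorm s <= M by rewrite le_max sM orbT.
  move=> {}sM; rewrite -(opprB z y) dotvNr => Hs.
  have := dotv_le s (z - y); have := ler_wpM2r (enorm_ge0 (z - y)) sM; lra.
exists d => //; exists M => //; split=> // y s yx /subdiff_EFin sy.
have [->|s0] := eqVneq s 0; first by rewrite enorm0 ltW.
have es0 : 0 < enorm s.
  by rewrite lt_def enorm_ge0 andbT; apply: contra_neq s0; exact: enorm_eq0.
(* The step along [s] has half the length of the gap left to the boundary of the ball. *)
pose t : R := (d - enorm (y - x)) / (2 * enorm s).
have t0 : 0 < t by rewrite divr_gt0 ?subr_gt0 ?mulr_gt0.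
have ts : enorm (t *: s) = (d - enorm (y - x)) / 2.
  by rewrite enormZ gtr0_norm// /t; field; rewrite gt_eqF.
have ytx : enorm (y + t *: s - x) < d.
  rewrite addrAC; apply: le_lt_trans (enormD _ _) _; rewrite ts; lra.
have := lip _ _ yx ytx; have := sy (y + t *: s).
rewrite [y + t *: s - y]addrAC subrr add0r dotvZr -enorm_sqr enormZ gtr0_norm//.
move=> H1 H2; rewrite -(ler_pM2l (mulr_gt0 t0 es0)); lra.
Qed.

Lemma continuous_finite_convex : continuous H.
Proof.
move=> x; apply/(@cvgrPdist_lt _ _ _ (nbhs x) _) => e e0.
have [d d0 [M M0 [lip _]]] := locally_lipschitz x.
apply/near_enorm; exists (Num.min d (e / M)); first by rewrite lt_min d0 divr_gt0.
move=> y; rewrite lt_min ltr_pdivlMr// => /andP[yd ye].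
have xd : enorm (x - x) < d by rewrite subrr enorm0.
have := lip _ _ xd yd; have := lip _ _ yd xd.
rewrite (enormC x y) ltr_norml; lra.
Qed.

Lemma continuous_finite_concave : continuous (fun y => - H y).
Proof. by move=> y; exact: (cvgN (continuous_finite_convex (x := y))). Qed.

(* Convexity of [H] along the segment turns the local inequality into a
   global one. *)
Lemma frechet_convex x s : frechet_subdiff (EFin \o H) x s -> dH x s.
Proof.
move=> /frechet_EFin sx; apply/subdiff_EFin => y; move: (y - x) (subrK x y) => h <-.
have [->|h0] := eqVneq h 0; first by rewrite dotv0r add0r addr0.
have eh0 : 0 < enorm h.
  by rewrite lt_def enorm_ge0 andbT; apply: contra_neq h0; exact: enorm_eq0.
apply/ler_addgt0Pr => e e0.
have [|d d0 dP] := sx (e / enorm h); first by rewrite divr_gt0.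
pose t : R := Num.min (2^-1) (d / (2 * enorm h)).
have t0 : 0 < t by rewrite lt_min invr_gt0 ltr0n divr_gt0 ?mulr_gt0.
have t1 : t <= 2^-1 by rewrite ge_min lexx.
have th : t * enorm h < d.
  have : t <= d / (2 * enorm h) by rewrite ge_min lexx orbT.
  rewrite ler_pdivlMr ?mulr_gt0//; lra.
have := dP (x + t *: h); rewrite [x + _ - x]addrAC subrr add0r enormZ gtr0_norm//.
move=> /(_ th); rewrite dotvZr.
have -> : e / enorm h * (t * enorm h) = e * t by field; rewrite gt_eqF.
(* Testing [u] at both ends of the segment, with weights [1 - t] and [t], gives the convexity
   inequality at the intermediate point. *)
have [u /subdiff_EFin ut] := subdiff_neq0 (x + t *: h).
have := ut (h + x); have := ut x.
have -> : h + x - (x + t *: h) = (1 - t) *: h by apply/rowP => i; rewrite !mxE; ring.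
have -> : x - (x + t *: h) = - t *: h by apply/rowP => i; rewrite !mxE; ring.
rewrite !dotvZr => Hx Hy Hf.
have t1' : 0 <= 1 - t by lra.
have := ler_wpM2l t1' Hx; have := ler_wpM2l (ltW t0) Hy.
move=> A B; rewrite -(ler_pM2l t0); lra.
Qed.

Lemma limiting_convex x : limiting_subdiff (EFin \o H) x = dH x.
Proof.
apply/seteqP; split=> [v [_ [xk [sk [xkx Hxk fk skv]]]]|s sx]; last first.
  apply/limiting_EFin; first exact: continuous_finite_convex.
  move=> e e0; exists x, s; rewrite !subrr enorm0; split => //.
  exact: subdiff_frechet.
apply/subdiff_EFin => y.
have cl : (fun k => H (xk k) + dotv (sk k) (y - xk k)) @ \oo -->
    H x + dotv v (y - x).
  apply: cvgD; first exact: (cvg_comp _ _ xkx (continuous_finite_convex (x := x))).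
  by apply: cvg_dotv => //; apply: cvgB => //; exact: cvg_cst.
apply: (closed_cvg (fun t : R => t <= H y) (@closed_le R (H y)) _ _ cl).
apply: nearW => k /=.
by have /frechet_convex/subdiff_EFin := fk k; exact.
Qed.

(* A Fréchet subgradient of the concave function [-H] forces differentiability
   of [H], so that the subdifferential of [H] is a singleton. *)
Lemma frechet_opp_subdiff x v s :
  frechet_subdiff (EFin \o (fun y => - H y)) x v -> dH x s -> s = - v.
Proof.
move=> /frechet_EFin vx /subdiff_EFin sx; apply/eqP; rewrite -addr_eq0; apply/eqP.
(* Along [h], the bounds from [s] and [v] add up to [t * |h|^2 <= t * |h|^2 / 2]. *)
have [h hE] : exists h, h = s + v by exists (s + v).
rewrite -hE; apply/enorm_eq0/eqP.
have [//|h0] := eqVneq (enorm h) 0.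
have eh0 : 0 < enorm h by rewrite lt_def h0 enorm_ge0.
have [|d d0 dP] := vx (enorm h / 2); first by rewrite divr_gt0.
pose t : R := d / (2 * enorm h).
have t0 : 0 < t by rewrite divr_gt0 ?mulr_gt0.
have th : t * enorm h < d.
  have -> : t * enorm h = d / 2 by rewrite /t; field; rewrite gt_eqF.
  by rewrite ltr_pdivrMr//; lra.
have := dP (x + t *: h); have := sx (x + t *: h).
rewrite [x + _ - x]addrAC subrr add0r enormZ gtr0_norm// => Hs /(_ th).
have hh : dotv s h + dotv v h = enorm h * enorm h by rewrite -dotvDl -hE -enorm_sqr.
rewrite dotvZr in Hs; rewrite dotvZr => Hv.
have : t * (enorm h * enorm h) <= t * (enorm h * enorm h) / 2.
  by rewrite -{1}hh; lra.
by have := mulr_gt0 t0 (mulr_gt0 eh0 eh0); lra.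
Qed.

(* For [K] large, a minimizer of [- H + K |. - x|^2] over a small ball around
   [x] is interior, by the Lipschitz bound, and carries a subgradient. *)
Lemma frechet_opp_dense x (e : R) : 0 < e -> exists y v,
  enorm (y - x) < e /\ frechet_subdiff (EFin \o (fun y => - H y)) y v.
Proof.
move=> e0; have [d d0 [M M0 [lip _]]] := locally_lipschitz x.
pose r : R := Num.min e d / 2.
have r0 : 0 < r by rewrite divr_gt0// lt_min e0.
have [re rd] : r < e /\ r < d.
  have : Num.min e d <= e by rewrite ge_min lexx.
  have : Num.min e d <= d by rewrite ge_min lexx orbT.
  by move: r0; rewrite /r; lra.
(* A minimizer at distance [r] from [x] would force [K * r <= M], against [K * r = 2 * M]. *)
pose K : R := 2 * M / r.
have K0 : 0 < K by rewrite divr_gt0// mulr_gt0.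
pose F y := - H y + (K * enorm (y - x) ^+ 2 + 0).
have [y yB ymin] : exists2 y, y \in [set y | enorm (y - x) <= r] &
    forall z, z \in [set y | enorm (y - x) <= r] -> F y <= F z.
  apply: EVT_min_rV; first by exists x; rewrite /= subrr enorm0 ltW.
    exact: eball_compact.
  apply: continuous_subspaceT => y; apply: (@cvgD _ _ _ (nbhs y) (nbhs_filter _)).
    exact: continuous_finite_concave.
  exact: continuous_quadratic.
move/set_mem : yB => /= yB.
have yxr : enorm (y - x) < r.
  have xd : enorm (x - x) < d by rewrite subrr enorm0.
  have := ymin x; rewrite /F subrr enorm0 expr0n mulr0 !addr0 => H1.
  have {}H1 : - H y + K * enorm (y - x) ^+ 2 <= - H x.
    by apply: H1; apply/mem_set; rewrite /= subrr enorm0 ltW.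
  have := lip _ _ xd (le_lt_trans yB rd) => H2.
  rewrite ltNge; apply/negP => ry.
  have H3 : K * enorm (y - x) ^+ 2 <= M * enorm (y - x) by lra.
  have yx0 := lt_le_trans r0 ry.
  have : K * enorm (y - x) <= M.
    by rewrite -(ler_pM2r yx0); move: H3; rewrite expr2; lra.
  have : K * r <= K * enorm (y - x) by rewrite ler_pM2l.
  by rewrite /K divfK ?gt_eqF//; lra.
(* This is the gradient at [y] of [- K |. - x|^2]; the remainder [K |z - y|^2] stays below the
   allowed error within radius [a / K]. *)
exists y, (- (2 * K) *: (y - x)); split; first by rewrite (lt_trans yxr).
apply/frechet_EFin => a a0.
exists (Num.min (r - enorm (y - x)) (a / K)).
  by rewrite lt_min subr_gt0 yxr divr_gt0.
move=> z; rewrite lt_min ltr_pdivlMr// => /andP[zr za].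
have zB : z \in [set y | enorm (y - x) <= r].
  by apply/mem_set => /=; have := enorm_tri z y x; lra.
have := ymin _ zB; rewrite /F !addr0.
have -> : z - x = (y - x) + (z - y) by rewrite [RHS]addrC addrA subrK.
move: za; move: (z - y) (y - x) => h g ha; rewrite !enorm_sqr !dotvE (dotvC h g).
have h0 := enorm_ge0 h; have <- := enorm_sqr h.
have := ler_wpM2l h0 (ltW ha); rewrite expr2; lra.
Qed.

(** Some subgradient of [H] exists at [xk k], and [frechet_opp_subdiff] identifies it with [- sk k];
    continuity of [H] carries the inequality to the limit. *)
Lemma limiting_opp_subset x :
  oppset (limiting_subdiff (EFin \o (fun y => - H y)) x) `<=` dH x.
Proof.
move=> _ [v [_ [xk [sk [xkx Hxk fk skv]]]] <-]; apply/subdiff_EFin => y.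
have cl : (fun k => H (xk k) + dotv (- sk k) (y - xk k)) @ \oo -->
    H x + dotv (- v) (y - x).
  apply: cvgD; first exact: (cvg_comp _ _ xkx (continuous_finite_convex (x := x))).
  by apply: cvg_dotv; [exact: cvgN|apply: cvgB => //; exact: cvg_cst].
apply: (closed_cvg (fun t : R => t <= H y) (@closed_le R (H y)) _ _ cl).
apply: nearW => k /=.
have [s sxk] := subdiff_neq0 (xk k).
have sE := frechet_opp_subdiff (fk k) sxk.
by move: sxk; rewrite sE => /subdiff_EFin; exact.
Qed.

(* The points [x + t d] are approached by points of differentiability of [H];
   monotonicity makes their gradients at least as large as [s] in the
   direction [d], in the limit. *)
Lemma limiting_opp_direction x s d : dH x s ->
  exists2 v, oppset (limiting_subdiff (EFin \o (fun y => - H y)) x) v &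
    dotv s d <= dotv v d.
Proof.
move=> sx; have [r r0 [M M0 [_ bnd]]] := locally_lipschitz x.
(* The summand 1 makes room for the distance, less than [t], between [y] and [x + t *: d]. *)
pose D : R := enorm d + 1.
have D0 : 0 < D by rewrite ltr_wpDl ?enorm_ge0.
have near_dir (e : R) : 0 < e -> exists y v,
    [/\ enorm (y - x) < e, frechet_subdiff (EFin \o (fun y => - H y)) y v,
        enorm v <= M & dotv s d - e <= dotv (- v) d].
  move=> e0; pose a : R := Num.min e r / D.
  have a0 : 0 < a by rewrite divr_gt0// lt_min e0.
  (* Chosen so that replacing [x + t *: d] by [y] in the monotonicity inequality costs at most
     [t * e]. *)
  pose b : R := e / (M + enorm s).
  have Ms : 0 < M + enorm s by rewrite ltr_pwDl// enorm_ge0.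
  have b0 : 0 < b by rewrite divr_gt0.
  pose t : R := Num.min a 1.
  have t0 : 0 < t by rewrite lt_min a0 ltr01.
  have [|y [v [yt vy]]] := @frechet_opp_dense (x + t *: d) (t * Num.min b 1).
    by rewrite mulr_gt0// lt_min b0 ltr01.
  have [ytb yt1] : enorm (y - (x + t *: d)) <= t * b /\
      enorm (y - (x + t *: d)) < t.
    split; first by rewrite (le_trans (ltW yt))// ler_pM2l// ge_min lexx.
    rewrite (lt_le_trans yt)// -[leRHS]mulr1 ler_pM2l// ge_min lexx orbT//.
  have yx : enorm (y - x) < Num.min e r.
    have : enorm (y - x) <= enorm (y - (x + t *: d)) + t * enorm d.
      rewrite -(gtr0_norm t0) -enormZ (gtr0_norm t0).
      by rewrite (le_trans _ (enormD _ _))// opprD addrA subrK.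
    have : t * D <= Num.min e r by rewrite -ler_pdivlMr// ge_min lexx.
    by rewrite /D; lra.
  move: yx; rewrite lt_min => /andP[ye yr].
  have [u uy] := subdiff_neq0 y.
  have uE := frechet_opp_subdiff vy uy.
  have uM := bnd _ _ yr uy.
  exists y, v; split => //; first by rewrite -enormN -uE.
  rewrite -uE; have := subdiff_monotone uy sx.
  have -> : y - x = t *: d + (y - (x + t *: d)).
    by apply/rowP => i; rewrite !mxE; ring.
  set g := y - _ in ytb *; rewrite dotvDr dotvZr => mon.
  have : dotv (u - s) g <= (M + enorm s) * (t * b).
    apply: le_trans (dotv_le _ _) _; apply: ler_pM; rewrite ?enorm_ge0//.
    by rewrite (le_trans (enormD _ _))// enormN lerD2r.
  have -> : (M + enorm s) * (t * b) = t * e by rewrite /b; field; rewrite gt_eqF.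
  have ud : dotv (u - s) d = dotv u d - dotv s d by rewrite dotvDl dotvNl.
  move=> ub; rewrite -(ler_pM2l t0); move: mon; rewrite ud; lra.
have /choice[z zP] (k : nat) : exists z : V * V,
    [/\ enorm (z.1 - x) < k.+1%:R^-1,
        frechet_subdiff (EFin \o (fun y => - H y)) z.1 z.2,
        enorm z.2 <= M & dotv s d - k.+1%:R^-1 <= dotv (- z.2) d].
  by have [|y [v yP]] := near_dir k.+1%:R^-1; [rewrite invr_gt0|exists (y, v)].
have small e : 0 < e -> \forall k \near \oo, (k.+1%:R^-1 : R) < e.
  by move=> e0; exact: (near_infty_natSinv_lt (PosNum e0)).
have [v [_ vcl]] : [set v : V | enorm (v - 0) <= M] `&`
    cluster ((z k).2 @[k --> \oo]) !=set0.
  apply: eball_compact; exists 0%N => // k _ /=.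
  by rewrite subr0; have [] := zP k.
(* A cluster point is approached at arbitrarily large indices, which stands in for a convergent
   subsequence. *)
have approx (e : R) : 0 < e -> exists k : nat,
    (k.+1%:R^-1 : R) < e /\ enorm ((z k).2 - v) < e.
  move=> e0.
  have [_ [[k /= ke <-] kv]] : (fun k => (z k).2) @` [set k : nat | (k.+1%:R^-1 : R) < e] `&`
      [set w | enorm (w - v) < e] !=set0.
    apply: vcl; last by apply/near_enorm; exists e.
    by apply: filterS (small _ e0) => k ke; exists k.
  by exists k.
exists (- v).
  exists v => //; apply/limiting_EFin; first exact: continuous_finite_concave.
  move=> e e0; have [k [ke kv]] := approx _ e0; have [zx zf _ _] := zP k.
  by exists (z k).1, (z k).2; split => //; exact: lt_trans ke.
apply/ler_addgt0Pr => e e0.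
have [|k [ke kv]] := approx (e / D); first by rewrite divr_gt0.
have [_ _ _] := zP k.
have : dotv (v - (z k).2) d <= (e / D) * enorm d.
  apply: le_trans (dotv_le _ _) _; apply: ler_wpM2r; first exact: enorm_ge0.
  by rewrite enormC ltW.
have : e / D * enorm d + e / D = e.
  by rewrite -[X in _ + X = _]mulr1 -mulrDr divfK// gt_eqF.
rewrite !dotvE; move: ke; move: (k.+1%:R^-1 : R) (e / D : R) => a b; lra.
Qed.

Lemma subdiff_conv_limiting x :
  dH x `<=` conv_hull (oppset (limiting_subdiff (EFin \o (fun y => - H y)) x)).
Proof.
move=> s sx; apply: contrapT => /strict_separation[|d dP].
  have [r r0 [M M0 [_ bnd]]] := locally_lipschitz x.
  set G := oppset _.
  have GE : G = (fun v => - v) @^-1`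
      limiting_subdiff (EFin \o (fun y => - H y)) x.
    apply/seteqP; split=> [_ [v vG <-]|v vG]; first by rewrite /= opprK.
    by exists (- v); rewrite ?opprK.
  (* The bound [bnd] on subgradients of [H] places the closed set [G] in a ball. *)
  apply: (subclosed_compact _ (@eball_compact R n 0 M)).
    rewrite GE; apply: preimage_closed.
      by move=> v _; exact: (cvgN (@cvg_id _ (nbhs v))).
    exact: limiting_closed continuous_finite_concave.
  move=> v /limiting_opp_subset/bnd; rewrite /= subr0; apply.
  by rewrite subrr enorm0.
have [v /dP vd sv] := limiting_opp_direction d sx.
by move: vd; rewrite ltNge sv.
Qed.

(** An element [u] of a monotone extension at [x] is compared with subgradients at points of the
    segment from [x] to [y]; letting these points tend to [x] gives the subgradient inequality. *)
Lemma subdiff_maximally_monotone : maximally_monotone dH.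
Proof.
split=> [|T mT dT x u Tu]; first exact: subdiff_monotone.
apply/subdiff_EFin => y.
have [s0 /subdiff_EFin s0x] := subdiff_neq0 x.
have key (t : R) : 0 < t <= 1 ->
    H x + t * dotv s0 (y - x) + (1 - t) * dotv u (y - x) <= H y.
  move=> /andP[t0 t1].
  have [st stx] := subdiff_neq0 (x + t *: (y - x)).
  have := mT _ _ _ _ (dT _ _ stx) Tu; have := s0x (x + t *: (y - x)).
  have /subdiff_EFin/(_ y) := stx.
  have -> : y - (x + t *: (y - x)) = (1 - t) *: (y - x).
    by apply/rowP => i; rewrite !mxE; ring.
  rewrite [x + _ - x]addrAC subrr add0r; move: (y - x) => h.
  rewrite !dotvZr => H1 H2; rewrite pmulr_rge0// dotvDl dotvNl => H3.
  have t1' : 0 <= 1 - t by lra.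
  have := ler_wpM2l t1' H3; lra.
apply/ler_addgt0Pr => e e0.
(* With [t = e / c], which is at most 1, [key] differs from the wanted inequality by at most [e]. *)
pose c : R := `|dotv s0 (y - x) - dotv u (y - x)| + e.
have c0 : 0 < c by rewrite ltr_wpDl.
have := key (e / c); rewrite divr_gt0//= ler_pdivrMr// mul1r lerDr normr_ge0.
move=> /(_ isT).
have : e / c * - (dotv s0 (y - x) - dotv u (y - x)) <= e.
  rewrite mulrAC ler_pdivrMr// ler_pM2l// /c.
  by have := ler_norm (- (dotv s0 (y - x) - dotv u (y - x))); rewrite normrN; lra.
lra.
Qed.

End finite_convex.

(** * Lower semicontinuity and attained minima on compact sets *)

Section lower_semicontinuity.
Local Open Scope ring_scope.
Variable R : realType.

Lemma lt_EFin_between (a : R) (z : \bar R) :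
  (a%:E < z)%E -> exists2 b : R, a < b & (b%:E < z)%E.
Proof.
case: z => [z||//]; last by move=> _; exists (a + 1); rewrite ?ltrDl ?ltry.
by rewrite lte_fin => az; exists ((a + z) / 2); rewrite ?lte_fin ?midf_lt.
Qed.

Lemma lsc_addr_continuous (T : topologicalType) (f : T -> \bar R) (g : T -> R) :
  lower_semicontinuous f -> continuous g ->
  lower_semicontinuous (fun x => f x + (g x)%:E)%E.
Proof.
move=> lf cg x a; rewrite -lteBlDr// -EFinB => /lt_EFin_between[b ab bf].
have [U xU Uf] := lf _ _ bf.
exists (U `&` g @^-1` [set t | a - b < t]).
  apply: filterI => //; apply: cg; apply: lt_nbhsr; lra.
move=> y [/Uf bfy /= aby]; rewrite -lteBlDr// -EFinB; apply: le_lt_trans bfy.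
rewrite lee_fin; lra.
Qed.

(** Were the infimum [r] not attained, compactness would give one [t > r] below all the values of
    [f] on [A]. *)
Lemma lsc_compact_min (T : topologicalType) (f : T -> \bar R) (A : set T) (b : R) :
  compact A -> lower_semicontinuous f -> (forall x, A x -> b%:E <= f x)%E ->
  (exists2 x, A x & f x < +oo)%E ->
  exists2 p, A p & forall x, A x -> (f p <= f x)%E.
Proof.
move=> cA lf bf [x0 Ax0 fx0]; pose m := ereal_inf (f @` A).
have mle x : A x -> (m <= f x)%E by move=> Ax; apply: ereal_inf_lbound; exists x.
have [r mr] : exists r : R, m = r%:E.
  have : (b%:E <= m)%E by apply: le_ereal_inf_tmp => _ [x Ax <-]; exact: bf.
  have : (m < +oo)%E by exact: le_lt_trans (mle _ Ax0) fx0.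
  by case: (m) => // r; exists r.
apply: contrapT => nmin.
have rf x : A x -> (r%:E < f x)%E.
  move=> Ax; rewrite ltNge; apply/negP => fxr; apply: nmin; exists x => // y Ay.
  by rewrite (le_trans fxr)// -mr mle.
have : \forall t \near r^'+, A `<=` (fun x => (t%:E < f x)%E).
  move/compact_near_coveringP : cA; apply => x Ax.
  have [a ra af] := lt_EFin_between (rf _ Ax); have [U xU Uf] := lf _ _ af.
  exists (U, [set t | t < a]) => /=; first by split => //; exact: nbhs_right_lt.
  by move=> [y t] [/= /Uf + ta]; apply: lt_trans; rewrite lte_fin.
move=> /(filterI (nbhs_right_gt r))/filter_ex[t [/= rt tf]].
have : (t%:E <= m)%E by apply: le_ereal_inf_tmp => _ [x Ax <-]; exact: ltW (tf x Ax).
by rewrite mr lee_fin leNgt rt.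
Qed.

End lower_semicontinuity.

(** * The proximal mapping and the Moreau envelope below the threshold *)

Section proximal_mapping.
Local Open Scope ring_scope.
Variables (R : realType) (n : nat).
Local Notation V := 'rV[R]_n.
Variables (f : V -> \bar R) (mu : R).
Hypothesis f_proper : proper_fun f.
Hypothesis f_lsc : lower_semicontinuous f.
Hypothesis mu_gt0 : 0 < mu.
Hypothesis mu_lt : (mu%:E < threshold f)%E.
Implicit Types (p u v w x y : V).

Let obj := prox_objective mu f.
Let g := fenchel_conj (mu_reg mu f).

Lemma proper_cases w : f w = +oo%E \/ exists r : R, f w = r%:E.
Proof.
have [/(_ w) + _] := f_proper.
by case: (f w) => [r _|_|//]; [right; exists r|left].
Qed.

(** The supremum defining the threshold supplies [l > mu] whose envelope at some [x0] is not [-oo];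
    a lower bound of that envelope, read pointwise in [w], is the minorant. *)
Lemma quadratic_minorant : exists2 l : R, mu < l & exists x0 (c : R),
  forall w, ((c - (2 * l)^-1 * enorm (w - x0) ^+ 2)%:E <= f w)%E.
Proof.
have [_ [l [l0 [x0 bx0]] <-]] := ereal_sup_gt mu_lt.
rewrite lte_fin => mul; exists l => //; exists x0.
have [c cx0] : exists c : R, (c%:E <= moreau l f x0)%E.
  by case: moreau bx0 => // [r _|_]; [exists r|exists 0; rewrite leey].
exists c => w; rewrite EFinB leeBlDr//; apply: le_trans cx0 _.
by apply: ereal_inf_lbound; exists w.
Qed.

(** Since [mu < l], the quadratic term of the objective dominates that of the minorant; Young's
    inequality recenters the latter from [x0] to [x]. *)
Lemma objective_growth : exists2 k : R, 0 < k & exists2 K : V -> R, continuous K &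
  forall x w, ((k * enorm (w - x) ^+ 2 - K x)%:E <= obj x w)%E.
Proof.
have [l mul [x0 [c cf]]] := quadratic_minorant.
have l0 : 0 < l by exact: lt_trans mul.
(* This Young parameter uses up half of the gap [(2 * mu)^-1 - (2 * l)^-1]; the other half is the
   growth coefficient. *)
pose d : R := (l - mu) / (2 * mu).
have d0 : 0 < d by rewrite divr_gt0 ?subr_gt0 ?mulr_gt0.
exists ((l - mu) / (4 * l * mu)); first by rewrite divr_gt0 ?subr_gt0 ?mulr_gt0.
exists (fun x => (2 * l)^-1 * (1 + d^-1) * enorm (x - x0) ^+ 2 + - c).
  exact: continuous_quadratic.
move=> x w; rewrite /obj /prox_objective; case: (proper_cases w) => [->|[r fw]].
  by rewrite addye ?leey.
have := cf w; rewrite fw -EFinD !lee_fin.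
have -> : w - x0 = (w - x) + (x - x0) by rewrite addrA subrK.
move: (w - x) (x - x0) => a b; rewrite !enorm_sqr !dotvE (dotvC b a) => H.
have l2 : 0 < (2 * l)^-1 by rewrite invr_gt0 mulr_gt0.
have young : 2 * dotv a b <= d * dotv a a + d^-1 * dotv b b.
  have d1 : 0 <= d^-1 by rewrite invr_ge0 ltW.
  have := mulr_ge0 d1 (dotvv_ge0 (d *: a - b)); rewrite !dotvE (dotvC b a).
  set E := (X in 0 <= X).
  have -> : E = d * dotv a a + d^-1 * dotv b b - 2 * dotv a b.
    by rewrite /E; field; rewrite gt_eqF.
  by rewrite subr_ge0.
have := ler_wpM2l (ltW l2) young.
have -> : (2 * mu)^-1 = (l - mu) / (4 * l * mu) + (2 * l)^-1 * (1 + d).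
  by rewrite /d; field; rewrite !gt_eqF.
move: (d^-1) (_ / _) => e k; lra.
Qed.

Lemma objective_sublevel : exists2 k : R, 0 < k & exists2 K : V -> R, continuous K &
  (forall x w, ((- K x)%:E <= obj x w)%E) /\
  forall x w (m : R), (obj x w <= m%:E)%E -> enorm (w - x) <= 1 + `|m + K x| / k.
Proof.
have [k k0 [K cK growth]] := objective_growth.
exists k => //; exists K => //; split => x w.
  apply: le_trans (growth x w); rewrite lee_fin lerDr mulr_ge0 ?sqr_ge0//.
  exact: ltW.
move=> m /(le_trans (growth x w)); rewrite lee_fin lerBlDr => H.
rewrite -lerBlDl ler_pdivlMr//; have := ler_norm (m + K x).
have := enorm_ge0 (w - x); move: (enorm _) H => t H t0.
have [t1|t1] := leP t 1.
  have : (t - 1) * k <= 0 by rewrite mulr_le0_ge0 ?subr_le0// ltW.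
  have := normr_ge0 (m + K x); lra.
have : k * t <= k * t ^+ 2 by rewrite ler_pM2l// expr2 ler_peMl// ltW.
lra.
Qed.

Lemma objective_lsc x : lower_semicontinuous (obj x).
Proof.
apply: lsc_addr_continuous => //.
rewrite (_ : (fun w => _) = fun w => (2 * mu)^-1 * enorm (w - x) ^+ 2 + 0).
  exact: continuous_quadratic.
by apply/funext => w; rewrite addr0.
Qed.

(** The objective is minimized over a ball containing the sublevel set of a point [w1] in the domain
    of [f]. *)
Lemma Prox_neq0 x : exists p, Prox mu f x p.
Proof.
have [_ [w1 fw1]] := f_proper.
have [k k0 [K cK [Kle Ksub]]] := objective_sublevel.
have [m mE] : exists m : R, obj x w1 = m%:E.
  rewrite /obj /prox_objective; case: (proper_cases w1) fw1 => [->//|[r -> _]].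
  by exists (r + (2 * mu)^-1 * enorm (w1 - x) ^+ 2).
pose S := [set w : V | enorm (w - x) <= 1 + `|m + K x| / k].
have Sw1 : S w1 by apply: Ksub; rewrite mE.
have [p Sp pmin] : exists2 p, S p & forall w, S w -> (obj x p <= obj x w)%E.
  apply: (@lsc_compact_min _ _ _ _ (- K x)); first exact: eball_compact.
  - exact: objective_lsc.
  - by move=> w _; exact: Kle.
  - by exists w1; rewrite // mE ltry.
exists p => w; have [wm|wm] := leP (obj x w) m%:E.
  by apply: pmin; exact: Ksub.
by apply: le_trans (ltW wm); rewrite -mE; exact: pmin.
Qed.

Lemma Prox_fin x p : Prox mu f x p -> exists r : R, f p = r%:E.
Proof.
move=> px; case: (proper_cases p) => // fp.
have [_ [w1]] := f_proper; case: (proper_cases w1) => [->//|[r fw1 _]].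
by have := px w1; rewrite /prox_objective fp fw1.
Qed.

(** Comparison with one fixed [w1] in the domain bounds the objective at a proximal point by a
    continuous function of [x]. *)
Lemma Prox_locally_bounded : exists2 N : V -> R, continuous N &
  forall x p, Prox mu f x p -> enorm (p - x) <= N x.
Proof.
have [_ [w1]] := f_proper; case: (proper_cases w1) => [->//|[r fw1 _]].
have [k k0 [K cK [_ Ksub]]] := objective_sublevel.
pose F x := (2 * mu)^-1 * enorm (x - w1) ^+ 2 + r + K x.
exists (fun x => 1 + `|F x| / k).
  have cF : continuous F.
    move=> x; apply: (@cvgD _ _ _ (nbhs x) (nbhs_filter _)); last exact: cK.
    exact: continuous_quadratic.
  move=> x; apply: (@cvgD _ _ _ (nbhs x) (nbhs_filter _)); first exact: cvg_cst.
  apply: (@cvgM _ _ (nbhs x) (nbhs_filter _)); last exact: cvg_cst.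
  exact: (@cvg_norm _ _ _ (nbhs x) (nbhs_filter _) _ _ (cF x)).
move=> x p px; apply: Ksub; apply: le_trans (px w1) _.
by rewrite /prox_objective fw1 (enormC w1 x) addrC.
Qed.

Lemma Prox_closed (xk pk : nat -> V) x p : xk @ \oo --> x -> pk @ \oo --> p ->
  (forall k, Prox mu f (xk k) (pk k)) -> Prox mu f x p.
Proof.
move=> xkx pkp Pk w; rewrite /prox_objective.
case: (proper_cases w) => [->|[r fw]]; first by rewrite addye ?leey.
pose q u v := (2 * mu)^-1 * enorm (u - v) ^+ 2.
(* If [w] beat [p] at [x], some [b] would lie strictly between the limit of the right-hand sides and
   [f p]; lower semicontinuity keeps [f (pk k)] above [b] while those sides fall below it. *)
rewrite fw -EFinD -leeBrDr// -EFinB leNgt; apply/negP => /lt_EFin_between[b rb bf].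
have [U pU Uf] := f_lsc bf.
have qc (u v : nat -> V) u0 v0 : u @ \oo --> u0 -> v @ \oo --> v0 ->
    q (u k) (v k) @[k --> \oo] --> q u0 v0.
  move=> uu vv; apply: cvgM; first exact: cvg_cst.
  rewrite enorm_sqr; under eq_fun do rewrite enorm_sqr.
  by apply: cvg_dotv; exact: cvgB.
have lim : (r + q w (xk k) - q (pk k) (xk k)) @[k --> \oo] --> r + q w x - q p x.
  apply: cvgB; last exact: qc.
  by apply: cvgD; [exact: cvg_cst|apply: qc => //; exact: cvg_cst].
have near_b : \forall k \near \oo, r + q w (xk k) - q (pk k) (xk k) < b.
  exact: cvgr_lt lim _ rb.
have near_U : \forall k \near \oo, U (pk k) := pkp _ pU.
have [k [kb /Uf]] := filter_ex (filterI near_b near_U).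
have := Pk k w; rewrite /prox_objective fw -EFinD -leeBrDr// -EFinB => fk bk.
by have := lt_le_trans bk fk; rewrite lte_fin ltNge ltW.
Qed.

Lemma conjugate_objective x w : ((dotv x w)%:E - mu_reg mu f w =
  (2^-1 * enorm x ^+ 2)%:E - mu%:E * obj x w)%E.
Proof.
rewrite /mu_reg /obj /prox_objective; case: (proper_cases w) => [->|[r ->]].
  by rewrite addye// !gt0_muley ?lte_fin// addye.
rewrite -!(EFinM, EFinD, EFinB); congr (_%:E).
rewrite !enorm_sqr !dotvE (dotvC w x); field.
by rewrite gt_eqF.
Qed.

Lemma moreau_Prox x p : Prox mu f x p -> moreau mu f x = obj x p.
Proof.
move=> px; apply/eqP; rewrite eq_le; apply/andP; split.
  by apply: ereal_inf_lbound; exists p.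
by apply: le_ereal_inf_tmp => _ [w _ <-]; exact: px.
Qed.

Lemma conjugate_Prox x p : Prox mu f x p -> g x = ((dotv x p)%:E - mu_reg mu f p)%E.
Proof.
move=> px; apply/eqP; rewrite eq_le; apply/andP; split; last first.
  by apply: ereal_sup_ubound; exists p.
apply: ge_ereal_sup => _ [w _ <-]; rewrite !conjugate_objective.
by rewrite leeB// lee_pmul2l ?lte_fin//; exact: px.
Qed.

Lemma conjugate_finE x : g x = (fine (g x))%:E.
Proof.
have [p px] := Prox_neq0 x; have [r fp] := Prox_fin px.
by rewrite (conjugate_Prox px) /mu_reg fp.
Qed.

Lemma moreau_conjugate x :
  moreau mu f x = (mu^-1 * (2^-1 * enorm x ^+ 2 - fine (g x)))%:E.
Proof.
have [p px] := Prox_neq0 x; have [r fp] := Prox_fin px.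
rewrite (moreau_Prox px) (conjugate_Prox px) conjugate_objective.
rewrite /obj /prox_objective fp; congr (_%:E) => /=.
by rewrite subKr mulKf// gt_eqF.
Qed.

(** The affine function attached to [p] in the supremum is a minorant of the conjugate and is exact
    at [x]. *)
Lemma Prox_subdiff x p : Prox mu f x p -> subdiff (EFin \o (fun y => fine (g y))) x p.
Proof.
move=> px; apply/subdiff_EFin => y; have [r fp] := Prox_fin px.
have : ((dotv y p)%:E - mu_reg mu f p <= g y)%E.
  by apply: ereal_sup_ubound; exists p.
rewrite conjugate_finE (conjugate_Prox px) /mu_reg fp /= lee_fin.
by rewrite dotvDr dotvNr (dotvC p y) (dotvC p x); lra.
Qed.

(** Supplies the hypothesis on which the results on finite convex functions rest, with proximal
    points as subgradients. *)
Lemma conjugate_subdiff_bounded x : exists2 d : R, 0 < d & exists M : R,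
  forall y, enorm (y - x) < d ->
    exists2 s, subdiff (EFin \o (fun y => fine (g y))) y s & enorm s <= M.
Proof.
have [N cN NP] := Prox_locally_bounded.
have /near_enorm[d d0 dN] : \forall y \near x, N y < N x + 1.
  by apply: (cN x [set t | t < N x + 1]); apply: lt_nbhsl; rewrite ltrDl.
exists (Num.min d 1); first by rewrite lt_min d0 ltr01.
exists (N x + 2 + enorm x) => y; rewrite lt_min => /andP[/dN Ny yx].
have [p py] := Prox_neq0 y; exists p; first exact: Prox_subdiff.
have := NP _ _ py; have := enormD (p - y) y; have := enormD (y - x) x.
rewrite !subrK; lra.
Qed.

Lemma limiting_opp_Prox x :
  oppset (limiting_subdiff (EFin \o (fun y => - fine (g y))) x) `<=` Prox mu f x.
Proof.
move=> _ [v [_ [xk [sk [xkx _ fk skv]]]] <-].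
apply: (@Prox_closed xk (fun k => - sk k)) => //; first exact: cvgN.
move=> k; have [p pk] := Prox_neq0 (xk k).
have pE := frechet_opp_subdiff (fk k) (Prox_subdiff pk).
by rewrite -pE.
Qed.

(** Under [mu_proximal] the objective is convex in [w], since it differs from [f + |.|^2 / (2 mu)]
    by an affine function. *)
Lemma Prox_convex x p u (t : R) : mu_proximal mu f -> 0 <= t <= 1 ->
  Prox mu f x p -> Prox mu f x u -> Prox mu f x (t *: p + (1 - t) *: u).
Proof.
move=> fc t01 px ux w.
have [r fp] := Prox_fin px; have [s fu] := Prox_fin ux.
apply: le_trans (px w); have := fc t p u t01; have := ux p.
have /andP[t0 t1] := t01.
rewrite /prox_objective fp fu -!(EFinD, EFinM).
case: (proper_cases (t *: p + (1 - t) *: u)) => [->//|[a ->]].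
rewrite -!EFinD !lee_fin !enorm_sqr !dotvE (dotvC x p) (dotvC x u) (dotvC u p).
have t1' : 0 <= 1 - t by rewrite subr_ge0.
move=> /(ler_wpM2l t1'); move: (_^-1) => c; lra.
Qed.

End proximal_mapping.

Theorem lemma3p1 (R : realType) (n : nat) (f : 'rV[R]_n -> \bar R) (mu : R)
    (f_proper : proper_fun f)
    (f_lsc : lower_semicontinuous f)
    (f_prox_bounded : prox_bounded f)
    (mu_gt0 : (0 < mu)%R)
    (mu_lt : mu%:E < threshold f) :
  [/\ (* (a) *)
      (forall x, conv_hull (Prox mu f x)
                 = subdiff (fenchel_conj (mu_reg mu f)) x)
        /\ maximally_monotone (fun x => conv_hull (Prox mu f x)),
      (* (b) *)
      (forall x, oppset (limiting_subdiff
                   (fun y => - fenchel_conj (mu_reg mu f) y) x)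
                 `<=` Prox mu f x),
      (* (c) *)
      (forall x, clarke_subdiff (moreau mu f) x
                 = oppset (limiting_subdiff (fun y => - moreau mu f y) x)
              /\ oppset (limiting_subdiff (fun y => - moreau mu f y) x)
                 = id_minus_over mu (fun y => conv_hull (Prox mu f y)) x) &
      (mu_proximal mu f ->
       forall x, clarke_subdiff (moreau mu f) x
                 = id_minus_over mu (Prox mu f) x)].
Proof.
pose H y := fine (fenchel_conj (mu_reg mu f) y).
have gE : fenchel_conj (mu_reg mu f) = EFin \o H.
  by apply/funext => y; exact: conjugate_finE.
have eE x : moreau mu f x = (mu^-1 * (2^-1 * enorm x ^+ 2 - H x))%:E.
  exact: moreau_conjugate.
have bH := conjugate_subdiff_bounded f_proper f_lsc mu_gt0 mu_lt.
have GP := limiting_opp_Prox f_proper f_lsc mu_gt0 mu_lt.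
have PH x : Prox mu f x `<=` subdiff (EFin \o H) x.
  by move=> p; exact: Prox_subdiff.
have convG x : conv_hull (oppset (limiting_subdiff (EFin \o (fun y => (- H y)%R)) x))
    = subdiff (EFin \o H) x.
  apply/seteqP; split; last exact: subdiff_conv_limiting.
  by apply: conv_hull_sub (@subdiff_convex _ _ H x) (limiting_opp_subset bH (x := x)).
(* The chain of inclusions closes up after taking hulls, because the subdifferential of [H] is
   convex. *)
have convP x : conv_hull (Prox mu f x) = subdiff (EFin \o H) x.
  apply/seteqP; split; first exact: conv_hull_sub (@subdiff_convex _ _ H x) (PH x).
  by rewrite -convG; exact: conv_hullS.
pose F x (p : 'rV[R]_n) := (mu^-1 *: (x - p))%R.
have affF x p u (t : R) :
    (F x (t *: p + (1 - t) *: u) = t *: F x p + (1 - t) *: F x u)%R.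
  by apply/rowP => i; rewrite !mxE; ring.
have mu1 : (0 < mu^-1)%R by rewrite invr_gt0.
(* Up to the term [mu^-1 |.|^2 / 2], the envelope is [- mu^-1 H]; the hull commutes with the affine
   map [F x], and [convG] applies. *)
have clarkeE x : clarke_subdiff (moreau mu f) x = F x @` subdiff (EFin \o H) x.
  have -> : moreau mu f =
      EFin \o (fun y => mu^-1 * - H y + mu^-1 * (2^-1 * enorm y ^+ 2))%R.
    by apply/funext => y; rewrite eE /= -mulrDr addrC.
  rewrite /clarke_subdiff limiting_quadE//; last exact: continuous_finite_concave.
  rewrite -convG -(conv_hull_image _ (affF x)); congr conv_hull.
  rewrite image_comp; congr (_ @` _); apply/funext => v.
  by rewrite /= /F opprK addrC scalerDr.
(* Here the non-quadratic part is [mu^-1 H], whose limiting subdifferential is already the convex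
   one; hence no hull is taken. *)
have limE x : oppset (limiting_subdiff (fun y => - moreau mu f y) x) =
    F x @` subdiff (EFin \o H) x.
  have -> : (fun y => - moreau mu f y) =
      EFin \o (fun y => mu^-1 * H y + - mu^-1 * (2^-1 * enorm y ^+ 2))%R.
    by apply/funext => y; rewrite eE /=; congr (_%:E); ring.
  rewrite limiting_quadE//; last exact: continuous_finite_convex.
  rewrite limiting_convex// /oppset image_comp; congr (_ @` _); apply/funext => v.
  by apply/rowP => i; rewrite !mxE; ring.
split.
- split=> [x|]; first by rewrite gE.
  by rewrite (_ : (fun x => _) = subdiff (EFin \o H));
    [exact: subdiff_maximally_monotone|exact/funext].
- by rewrite gE; exact: GP.
- by move=> x; rewrite clarkeE limE /id_minus_over convP.
- move=> fprox x; rewrite clarkeE -convP conv_hull_id// => p u t t01.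
  exact: Prox_convex.
Qed.
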